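(* Let $V$ be a 3-dimensional complex vector space with a Hermitian form $h$ of signature $(2,1)$. Let $z_1,z_2,z_3\in V$ be non-null vectors, $a_i=h(z_i,z_i)\neq 0$, $h_{ij}=h(z_i,z_j)$, and $$C_{2,ij}=\frac{h_{ij}h_{ji}}{a_ia_j},\qquad C_{3,123}=\frac{h_{12}h_{23}h_{31}}{a_1a_2a_3}.$$ Then $$C_{3,123}\,\overline{C_{3,123}}=C_{2,12}\,C_{2,23}\,C_{2,31},$$ so the modulus of $C_{3,123}$ is determined by the three pair cycles $C_{2,12},C_{2,23},C_{2,31}$, and when $C_{3,123}\neq0$ its remaining contribution is its phase $\arg C_{3,123}$. Moreover, with $T_H=-h_{12}h_{23}h_{31}$, whenever $T_H\neq 0$ one has $$\frac{T_H}{|T_H|}=-\operatorname{sgn}(a_1a_2a_3)\,\frac{C_{3,123}}{|C_{3,123}|},$$ so that the phase of $T_H$ differs from that of $C_{3,123}$ only by the real sign $-\operatorname{sgn}(a_1a_2a_3)$, determined by the signs of $h(z_1,z_1),h(z_2,z_2),h(z_3,z_3)$.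
   Context: $h$ is linear in the first argument and conjugate-linear in the second, with $h(w,z)=\overline{h(z,w)}$; a vector $z$ is non-null if $h(z,z)\neq0$. $C_{2,ij}$ is called the pair cycle, $C_{3,123}$ the normalized triple cycle, and $T_H$ the Hermitian triple product. *)

(* Defs.v *)
From HB Require Import structures.
From mathcomp Require Import all_boot all_order all_algebra.
From mathcomp Require Import complex.
From mathcomp Require Import classical_sets reals trigo.

Set Implicit Arguments.
Unset Strict Implicit.
Unset Printing Implicit Defensive.

Import Order.TTheory GRing.Theory Num.Theory.
Local Open Scope ring_scope.

(* The library's forms {hermitian_sym V for Num.conj} are linear in the first
   argument, conjugate-linear in the second, and satisfy h x y = (h y x)^*. *)

(* By Sylvester's law of inertia, signature (p, q) means that V has an
   h-orthogonal basis normalized to p squares 1 and q squares -1. *)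
Definition has_signature (R : realType) (V : vectType R[i])
    (h : {hermitian_sym V for Num.conj}) (p q : nat) : Prop :=
  exists e : (p + q).-tuple V, basis_of {: V} e /\
    forall i j : 'I_(p + q), h (tnth e i) (tnth e j) =
      if i == j then (if (i < p)%N then 1 else -1) else 0.

Definition non_null (R : realType) (V : vectType R[i])
    (h : {hermitian_sym V for Num.conj}) (z : V) : Prop := h z z != 0.

Definition pair_cycle (R : realType) (V : vectType R[i])
    (h : {hermitian_sym V for Num.conj}) (z w : V) : R[i] :=
  (h z w * h w z) / (h z z * h w w).

Definition triple_cycle (R : realType) (V : vectType R[i])
    (h : {hermitian_sym V for Num.conj}) (x y z : V) : R[i] :=
  (h x y * h y z * h z x) / (h x x * h y y * h z z).

Definition hermitian_triple_product (R : realType) (V : vectType R[i])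
    (h : {hermitian_sym V for Num.conj}) (x y z : V) : R[i] :=
  - (h x y * h y z * h z x).

Definition expi (R : realType) (t : R) : R[i] := Complex (cos t) (sin t).

(* Principal argument; its value at 0 is irrelevant. *)
Definition arg (R : realType) (z : R[i]) : R :=
  xget 0 [set t : R | (- pi < t <= pi) /\ z = `|z| * expi t]%classic.

(* Main.v *)
Require Import Defs.
From mathcomp Require Import all_boot all_order all_algebra.
From mathcomp Require Import complex reals.
From mathcomp Require Import classical_sets trigo.
From mathcomp Require Import ring.

Import Order.TTheory GRing.Theory Num.Theory.
Local Open Scope ring_scope.

(** Hermitian symmetry makes conjugation swap the arguments of [h], so multiplying [triple_cycle] by
    its conjugate pairs each h_ij with h_ji, while the real a_i become squares; regrouping gives the
    three pair cycles ([triple_cycle_mul_conj]). Since this product is the squared modulus, its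
    square root is the modulus, and the polar form supplies the rest. For the phases, T_H = -(a1 a2
    a3) C_3 with a1 a2 a3 real and nonzero; dividing by moduli leaves minus the sign of a1 a2 a3
    times the phase of C_3. The a_i live in [R[i]], where the order is only partial, so the sign
    lemmas ask for real elements. *)

Lemma real_sgrM (F : numDomainType) :
  {in Num.real &, {morph @Num.sg F : x y / x * y}}.
Proof.
move=> x y xR yR.
case: (real_ltgt0P xR) => [x0|x0|->]; last by rewrite !(mul0r, sgr0).
all: case: (real_ltgt0P yR) => [y0|y0|->]; last by rewrite !(mulr0, sgr0).
- by rewrite (gtr0_sg x0) (gtr0_sg y0) mulr1 gtr0_sg // mulr_gt0.
- by rewrite (gtr0_sg x0) (ltr0_sg y0) mul1r ltr0_sg // pmulr_rlt0.
- by rewrite (ltr0_sg x0) (gtr0_sg y0) mulr1 ltr0_sg // nmulr_rlt0.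
- by rewrite (ltr0_sg x0) (ltr0_sg y0) mulrNN mulr1 gtr0_sg // nmulr_rgt0.
Qed.

Lemma real_divr_norm (F : numFieldType) (x : F) :
  x \is Num.real -> x / `|x| = Num.sg x.
Proof.
move=> xR; have [->|x0] := eqVneq x 0; first by rewrite mul0r sgr0.
by rewrite {1}(realEsg xR) mulfK // normr_eq0.
Qed.

Lemma real_sgr_neq0 (F : numDomainType) (x : F) :
  x \is Num.real -> x != 0 -> Num.sg x = 1 \/ Num.sg x = -1.
Proof.
move=> xR; case: (real_ltgt0P xR) => [x0|x0|//] _.
- by left; rewrite gtr0_sg.
- by right; rewrite ltr0_sg.
Qed.

Section Argument.
Variable R : realType.
Implicit Type z : R[i].

(** Scaling to modulus 1 leaves a point of the unit circle, whose angle is [acos] of its real part,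
    up to the sign of its imaginary part. Existence here means that [arg] never takes its default
    value. *)
Lemma polar_form z :
  exists t : R, (- pi < t <= pi) /\ z = `|z| * expi t.
Proof.
have [->|z0] := eqVneq z 0.
  (* At 0 any angle in the range works. *)
  by exists pi; rewrite lexx normr0 mul0r gtrN // pi_gt0.
suff unit_case (x y : R) : x ^+ 2 + y ^+ 2 = 1 ->
    exists t : R, (- pi < t <= pi) /\ Complex x y = expi t.
  have : `|z / `|z| | = 1 by rewrite normf_div normr_id divff ?normr_eq0.
  case E: (z / `|z|) => [x y] /(congr1 (fun w => w ^+ 2)) xy1.
  have /unit_case[t [tpi zt]] : x ^+ 2 + y ^+ 2 = 1.
    move: xy1; rewrite normc_def expr1n /= -rmorphXn /=.
    by rewrite sqr_sqrtr ?addr_ge0 ?sqr_ge0 // => -[].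
  exists t; split=> //.
  by rewrite -zt -E mulrC divfK ?normr_eq0.
move=> xy1; have x2_le1 : x ^+ 2 <= 1 by rewrite -xy1 lerDl sqr_ge0.
have x_bnd : -1 <= x <= 1.
  by rewrite -ler_norml -(expr_le1 (n := 2)) // real_normK ?num_real.
have sinE : sin (acos x) = `|y|.
  by rewrite sin_acos // -xy1 addrAC subrr add0r sqrtr_sqr.
have cosE : cos (acos x) = x by case: (acos_def x_bnd).
have [y_ge0|y_lt0] := leP 0 y.
  exists (acos x); split; last by rewrite /expi cosE sinE ger0_norm.
  rewrite acos_lepi // andbT (lt_le_trans _ (acos_ge0 x_bnd)) //.
  by rewrite oppr_lt0 pi_gt0.
exists (- acos x); split; last first.
  by rewrite /expi cosN sinN cosE sinE ltr0_norm // opprK.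
(* The range excludes [- pi], so [acos x < pi] is needed on the lower half circle; [x = -1] would
   force [y = 0]. *)
have x_gtN1 : -1 < x.
  have [x_le _] := andP x_bnd; rewrite lt_neqAle x_le andbT.
  apply/eqP => xN1; move: xy1; rewrite -xN1 sqrrN expr1n -[RHS]addr0.
  by move/addrI/eqP; rewrite sqrf_eq0 lt_eqF.
have [_ x_le1] := andP x_bnd.
rewrite ltrN2 acos_ltpi ?x_gtN1 //=.
by rewrite (le_trans _ (pi_ge0 R)) // oppr_le0 acos_ge0.
Qed.

Lemma polar_arg z : z = `|z| * expi (arg z).
Proof. by have [] := xgetPex 0 (polar_form z). Qed.

(** This carries the identity between unit phases over to principal arguments. *)
Lemma expi_arg z : z != 0 -> expi (arg z) = z / `|z|.
Proof.
by move=> z0; rewrite {2}(polar_arg z) mulrAC divff ?mul1r ?normr_eq0.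
Qed.

End Argument.

Section Cycles.
Variables (R : realType) (V : vectType R[i]).
Variable h : {hermitian_sym V for Num.conj}.
Implicit Types x y z : V.

Lemma herm_conj x y : (h x y)^* = h y x.
Proof. by rewrite (hermC h y x) expr0 mul1r. Qed.

Lemma herm_real x : h x x \is Num.real.
Proof. by apply/CrealP; exact: herm_conj. Qed.

Lemma triple_cycle_mul_conj x y z :
  triple_cycle h x y z * (triple_cycle h x y z)^* =
  pair_cycle h x y * pair_cycle h y z * pair_cycle h z x.
Proof.
(* The case [x = y] of [herm_conj] fixes the denominators; once inverses are distributed, both sides
   are the same monomial. *)
rewrite /triple_cycle /pair_cycle !(rmorphM, fmorphV) /= !herm_conj !invfM.
ring.
Qed.

End Cycles.

Theorem theorem8p4 (R : realType) (V : vectType R[i])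
    (h : {hermitian_sym V for Num.conj}) (z1 z2 z3 : V)
    (dimV : \dim {: V} = 3%N) (sign_h : has_signature h 2 1)
    (z1_nn : non_null h z1) (z2_nn : non_null h z2) (z3_nn : non_null h z3) :
  let a1 := h z1 z1 in
  let a2 := h z2 z2 in
  let a3 := h z3 z3 in
  let C2_12 := pair_cycle h z1 z2 in
  let C2_23 := pair_cycle h z2 z3 in
  let C2_31 := pair_cycle h z3 z1 in
  let C3_123 := triple_cycle h z1 z2 z3 in
  let TH := hermitian_triple_product h z1 z2 z3 in
  [/\ C3_123 * C3_123^* = C2_12 * C2_23 * C2_31,
      `|C3_123| = sqrtC (C2_12 * C2_23 * C2_31),
      C3_123 != 0 ->
        C3_123 = sqrtC (C2_12 * C2_23 * C2_31) * expi (arg C3_123),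
      TH != 0 ->
        TH / `|TH| = - Num.sg (a1 * a2 * a3) * (C3_123 / `|C3_123|) /\
        expi (arg TH) = - Num.sg (a1 * a2 * a3) * expi (arg C3_123)
    & [/\ [/\ a1 \is Num.real, a2 \is Num.real & a3 \is Num.real],
          Num.sg (a1 * a2 * a3) = 1 \/ Num.sg (a1 * a2 * a3) = -1
        & Num.sg (a1 * a2 * a3) = Num.sg a1 * Num.sg a2 * Num.sg a3] ].
Proof.
move=> a1 a2 a3 C2_12 C2_23 C2_31 C TH.
have CC : C * C^* = C2_12 * C2_23 * C2_31 by exact: triple_cycle_mul_conj.
have nC : `|C| = sqrtC (C2_12 * C2_23 * C2_31) by rewrite -CC -normCK sqrCK.
have [a1R a2R a3R] :
    [/\ a1 \is Num.real, a2 \is Num.real & a3 \is Num.real].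
  by split; apply: herm_real.
have a12R : a1 * a2 \is Num.real by rewrite realM.
have aR : a1 * a2 * a3 \is Num.real by rewrite realM.
have a0 : a1 * a2 * a3 != 0 by rewrite !mulf_neq0.
have THE : TH = - (a1 * a2 * a3 * C).
  by rewrite /TH /hermitian_triple_product /C /triple_cycle [in RHS]mulrC divfK.
have phase : TH / `|TH| = - Num.sg (a1 * a2 * a3) * (C / `|C|).
  by rewrite THE normrN normrM mulNr -mulf_div real_divr_norm // mulNr.
split=> //.
- by rewrite -nC => _; exact: polar_arg.
- move=> TH0; split=> //; rewrite !expi_arg //.
  (* [expi_arg] for [C] needs [C] nonzero, which follows from [TH] being its multiple. *)
  by apply: contraNneq TH0 => C0; rewrite THE C0 mulr0 oppr0.
- split=> //; first exact: real_sgr_neq0.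
  by rewrite !real_sgrM.
Qed.
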